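(* Let $G=(V,E)$ be a connected graph with $n$ vertices and maximum degree $\Delta$, let $k\in\{2,\dots,n-1\}$, let $\mathscr{S}$ be a $k$-block system for $G$ and let $\psi$ be the uniform distribution on $\mathscr{S}$. Fix $\lambda>1$. If $q\ge 2^{k+1}\Delta^{2k}k^{2k+1}\lambda^{\Delta-1+k^{-1}}$, then for every $\varepsilon>0$, $\tau(\mathcal{M}_{\mathrm{BD}}^{\mathscr{S},\psi}(G,\lambda,q),\varepsilon)\le 2n\log(n\varepsilon^{-1})$.
   Context: Potts model on $G$: configurations $\sigma\in\Omega=[q]^V$, $\mu(\sigma)$ = number of monochromatic edges, Gibbs distribution $\pi(\sigma)\propto\lambda^{\mu(\sigma)}$. $\tau(\mathcal{M},\varepsilon)=\max_x\min\{t:\|P^t(x,\cdot)-\pi\|_{TV}\le\varepsilon\}$. A $k$-block system for $G$ is a family $\mathscr{S}=\{S_v:v\in V\}$ with $v\in S_v$, $|S_v|=k$ and $G[S_v]$ connected. For $S\subseteq V$, $X\in\Omega$, $c\in[q]^S$: $X^{(S,c)}$ equals $c$ on $S$ and $X$ off $S$, and $\mu_{X,S}(c)$ is the number of monochromatic edges of $X^{(S,c)}$ incident with at least one vertex of $S$. The $(\mathscr{S},\psi)$-block dynamics $\mathcal{M}_{\mathrm{BD}}^{\mathscr{S},\psi}(G,\lambda,q)$ is the chain on $\Omega$ which from $X_t$ picks $S\in\mathscr{S}$ according to $\psi$, picks $c\in[q]^S$ with probability proportional to $\lambda^{\mu_{X_t,S}(c)}$, and moves to $X_t^{(S,c)}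$.
   Formalization: The formal theorem takes 0 < ε < 1 instead of every ε > 0: for ε > n the bound 2n log(n/ε) is negative, so the claim fails, and for 1 ≤ ε ≤ n it is trivial, since total variation distance is at most 1 and the mixing time is 0. *)

(* Defs.v *)
From mathcomp Require Import all_boot.
From Stdlib Require Import Reals.
Set Implicit Arguments. Unset Strict Implicit. Unset Printing Implicit Defensive.

Local Open Scope R_scope.

Section Potts.
Variables (V : finType) (adj : rel V).

Definition simple_graph : Prop :=
  (forall u v, adj u v = adj v u) /\ (forall v, adj v v = false).

Definition connected_graph : Prop := forall u v : V, connect adj u v.

Definition degree (v : V) : nat := #|[set u | adj v u]|.

Definition max_degree : nat := (\max_(v : V) degree v)%N.

Definition edges : {set {set V}} :=
  [set e : {set V} | [exists u, exists w, adj u w && (e == [set u; w])]].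

Definition induced_rel (S : {set V}) : rel V :=
  [rel x y | [&& adj x y, x \in S & y \in S]].

Definition induced_connected (S : {set V}) : Prop :=
  forall x y, x \in S -> y \in S -> connect (induced_rel S) x y.

Definition block_system (k : nat) (S : V -> {set V}) : Prop :=
  forall v, [/\ v \in S v, #|S v| = k & induced_connected (S v)].

Variable q : nat.
Definition config := {ffun V -> 'I_q}.

Definition monochromatic (s : config) (e : {set V}) : bool :=
  [forall u in e, forall w in e, s u == s w].

Definition mu (s : config) : nat := #|[set e in edges | monochromatic s e]|.

Definition block_col (S : {set V}) := {ffun {x : V | x \in S} -> 'I_q}.

Definition upd (X : config) (S : {set V}) (c : block_col S) : config :=
  [ffun v => if insub v is Some x then c x else X v].

Definition mu_block (X : config) (S : {set V}) (c : block_col S) : nat :=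
  #|[set e in edges | monochromatic (upd X c) e && (e :&: S != set0)]|.

Definition rsum (T : finType) (F : T -> R) : R := \big[Rplus/0]_(x : T) F x.

Variable lam : R.

Definition gibbs (s : config) : R :=
  lam ^ mu s / rsum (fun t : config => lam ^ mu t).

Definition block_update (X : config) (S : {set V}) (Y : config) : R :=
  rsum (fun c : block_col S =>
          if upd X c == Y then lam ^ mu_block X c else 0)
  / rsum (fun c : block_col S => lam ^ mu_block X c).

Definition BD (Sys : V -> {set V}) (X Y : config) : R :=
  rsum (fun v : V => / INR #|V| * block_update X (Sys v) Y).

Fixpoint step_dist (P : config -> config -> R) (x : config) (t : nat)
  : config -> R :=
  match t with
  | O => fun y => if y == x then 1 else 0
  | S t' => fun y => rsum (fun z => step_dist P x t' z * P z y)
  end.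

Definition tv_dist (m1 m2 : config -> R) : R :=
  / 2 * rsum (fun y => Rabs (m1 y - m2 y)).

(* tau(M, eps) <= T, i.e. max_x min{t : ||P^t(x,.) - pi||_TV <= eps} <= T *)
Definition mixing_time_le (P : config -> config -> R) (pi : config -> R)
  (eps T : R) : Prop :=
  forall x : config, exists t : nat,
    INR t <= T /\ tv_dist (step_dist P x t) pi <= eps.

End Potts.

Arguments gibbs {V} adj q lam s.
Arguments BD {V} adj q lam Sys X Y.

(* Main.v *)
(** Path coupling in dual form: if one step of the chain contracts the Lipschitz
    constant of every function, with respect to the Hamming distance, by the
    factor [1 - 3 / (4 n)], then the total variation distance to the stationary
    distribution after [t] steps is at most [n (1 - 3 / (4 n)) ^ t].

    Let [X] and [Y] differ only at [u].  A block containing [u] erases the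
    difference, and at least one of the [n] blocks does; a block not adjacent to
    [u] keeps it.  For a block [S] adjacent to [u] the two conditional
    distributions on [S] differ only through colourings of [S] using the colour
    of [u].  A Peierls argument bounds their probability by [2 ^ k * L / q],
    where [L = lam ^ (Delta - 1 + 1 / k)]: since [S] is connected, a colour class
    with [t] vertices in [S] meets at most [t * (Delta - 1 + 1 / k)]
    monochromatic edges.  At most [(1 + Delta) ^ k] blocks are adjacent to [u],
    so the lower bound on [q] makes their total effect at most [1 / 4]. *)

From HB Require Import structures.
Require Import Defs.
From mathcomp Require Import all_boot zify_ssreflect.
From Stdlib Require Import Reals Lra.
From Stdlib Require Znat.
Set Implicit Arguments. Unset Strict Implicit. Unset Printing Implicit Defensive.

(** * Finite sums of real numbers *)

Section RealSums.
Local Open Scope R_scope.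

(** These structures let the generic lemmas on big operators apply to [rsum]. *)
HB.instance Definition _ := Monoid.isComLaw.Build R 0 Rplus
  (fun x y z => esym (Rplus_assoc x y z)) Rplus_comm Rplus_0_l.
HB.instance Definition _ := Monoid.isMulLaw.Build R 0 Rmult
  Rmult_0_l Rmult_0_r.
HB.instance Definition _ := Monoid.isAddLaw.Build R Rmult Rplus
  Rmult_plus_distr_r Rmult_plus_distr_l.

Variable T : finType.
Implicit Types F G : T -> R.

Lemma eq_rsum F G : F =1 G -> rsum F = rsum G.
Proof. by move=> eqFG; apply: eq_bigr => x _; apply: eqFG. Qed.

Lemma rsum_le F G : (forall x, F x <= G x) -> rsum F <= rsum G.
Proof.
move=> leFG; rewrite /rsum; elim/big_rec2: _ => [|x a b _ leab]; first lra.
by move: (leFG x); lra.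
Qed.

Lemma rsum_add F G : rsum (fun x => F x + G x) = rsum F + rsum G.
Proof. exact: big_split. Qed.

Lemma rsum_mull a F : rsum (fun x => a * F x) = a * rsum F.
Proof. by rewrite /rsum big_distrr. Qed.

Lemma rsum_mulr a F : rsum (fun x => F x * a) = rsum F * a.
Proof. by rewrite /rsum big_distrl. Qed.

Lemma rsum_sub F G : rsum (fun x => F x - G x) = rsum F - rsum G.
Proof.
rewrite (@eq_rsum _ (fun x => F x + (-1) * G x)) => [|x]; last lra.
by rewrite rsum_add rsum_mull; lra.
Qed.

Lemma rsum_const a : rsum (fun _ : T => a) = INR #|T| * a.
Proof.
rewrite /rsum big_const; elim: #|T| => [|m IH]; first by rewrite /=; lra.
by rewrite iterS IH S_INR; lra.
Qed.

Lemma rsum_delta (a : T) F : rsum (fun x => if x == a then F x else 0) = F a.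
Proof. by rewrite /rsum -big_mkcond big_pred1_eq. Qed.

Lemma rsum_ge_term F a : (forall x, 0 <= F x) -> F a <= rsum F.
Proof.
move=> F0; rewrite -(rsum_delta a F); apply: rsum_le => x.
by case: eqP => // _; lra.
Qed.

Lemma rsum_pos F (a : T) : (forall x, 0 < F x) -> 0 < rsum F.
Proof.
move=> F0; have := @rsum_ge_term F a (fun x => Rlt_le _ _ (F0 x)).
by move: (F0 a); lra.
Qed.

Lemma rsum_card (A : {pred T}) :
  rsum (fun x => if x \in A then 1 else 0) = INR #|A|.
Proof.
rewrite /rsum -big_mkcond; transitivity (iter #|A| (Rplus 1) 0).
  exact: big_const.
elim: #|A| => [|m IH]; first by [].
by rewrite iterS IH S_INR; lra.
Qed.

(** Off [B] the normalised [F] stays below the normalised [G], since [F] is smaller there and has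
    the larger total. So all the excess of [F] sits on [B], and the l1 distance of two probability
    vectors is twice the excess. *)
Lemma normalised_l1_dist F G (B : pred T) :
    (forall x, 0 <= F x) -> (forall x, 0 <= G x) -> 0 < rsum G <= rsum F ->
    (forall x, ~~ B x -> F x <= G x) ->
  rsum (fun x => Rabs (F x / rsum F - G x / rsum G))
    <= 2 * (rsum (fun x => if B x then F x else 0) / rsum F).
Proof.
move=> F0 G0 [Gpos GF] leFG; set ZF := rsum F; set ZG := rsum G.
have ZGpos : 0 < ZG by [].
have ZFpos : 0 < ZF by apply: Rlt_le_trans GF.
have inv_le : / ZF <= / ZG by apply: Rinv_le_contravar.
have iF0 : 0 < / ZF by apply: Rinv_0_lt_compat.
have iG0 : 0 < / ZG by apply: Rinv_0_lt_compat.
(* The subtracted difference sums to zero, both vectors having total mass 1, so only the mass of [B]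
   survives summation. *)
have step x : Rabs (F x / ZF - G x / ZG) <=
    2 * ((if B x then F x else 0) * / ZF) - (F x * / ZF - G x * / ZG).
  have pF : 0 <= F x * / ZF by apply: Rmult_le_pos => //; lra.
  have pG : 0 <= G x * / ZG by apply: Rmult_le_pos => //; lra.
  rewrite /Rdiv; case: ifPn => [_|/leFG leF]; first by apply: Rabs_le; lra.
  have : F x * / ZF <= G x * / ZG.
    by apply: Rmult_le_compat => //; lra.
  by rewrite Rmult_0_l => leFG'; apply: Rabs_le; lra.
apply: Rle_trans (rsum_le step) _.
rewrite rsum_sub rsum_mull rsum_sub !rsum_mulr -/ZF -/ZG.
by rewrite /Rdiv !Rinv_r; lra.
Qed.

End RealSums.

Lemma rsum_exchange (T U : finType) (F : T -> U -> R) :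
  rsum (fun x => rsum (F x)) = rsum (fun y => rsum (F^~ y)).
Proof. exact: exchange_big. Qed.

Lemma exp_scale (m : nat) (x : R) : (exp (INR m * x) = exp x ^ m)%R.
Proof.
elim: m => [|m IH]; first by rewrite Rmult_0_l exp_0.
by rewrite S_INR Rmult_plus_distr_r Rmult_1_l exp_plus IH /= Rmult_comm.
Qed.

Lemma exists_nat_floor (T : R) : (0 <= T)%R ->
  exists t : nat, (INR t <= T < INR t + 1)%R.
Proof.
move=> T0; have [up1 up2] := archimed T.
have up_ge1 : (1 <= up T)%Z by apply/Z.lt_pred_le/lt_IZR; rewrite /=; lra.
exists (Z.to_nat (up T - 1)).
rewrite INR_IZR_INZ Znat.Z2Nat.id ?minus_IZR; first lra.
by apply/Z.le_0_sub.
Qed.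

(** * Balls and spanning trees of a relation *)

Section Balls.
Variable V : finType.
Implicit Types (e : rel V) (r v : V).

Definition ball e r m : {set V} :=
  iter m (fun A => A :|: [set v | [exists u in A, e u v]]) [set r].

Lemma ballS e r m v : (v \in ball e r m.+1) =
  (v \in ball e r m) || [exists u in ball e r m, e u v].
Proof. by rewrite /ball iterS !inE. Qed.

Lemma sub_ball e r m m' : m <= m' -> ball e r m \subset ball e r m'.
Proof.
move=> /subnK <-; elim: (m' - m) => [|j IH]; first exact: subxx.
by apply: subset_trans IH _; apply/subsetP=> v vB; rewrite addSn ballS vB.
Qed.

Lemma last_path_ball e r p : path e r p -> last r p \in ball e r (size p).
Proof.
elim/last_ind: p => [|p x IH]; first by rewrite inE.
rewrite rcons_path last_rcons size_rcons ballS => /andP[ep ex].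
by apply/orP; right; apply/existsP; exists (last r p); rewrite IH.
Qed.

(** Parents are chosen at strictly smaller distance from [r]. Of acyclicity only the absence of
    2-cycles is recorded: it says that no two parent darts are reverse to each other, which is what
    the edge count below needs. *)
Lemma spanning_tree e r (S : {set V}) :
    (forall v, v \in S -> connect e r v) ->
  exists2 p : V -> V, forall v, v \in S -> v != r -> e (p v) v
    & forall v w, v \in S -> w \in S -> v != r -> w != r ->
        p v = w -> p w <> v.
Proof.
move=> conn.
have reach v : exists m, (v \in S) ==> (v \in ball e r m).
  have [vS|_] := boolP (v \in S); last by exists 0.
  have /connectP[p ep ->] := conn v vS.
  by exists (size p); apply: last_path_ball.
pose depth v := ex_minn (reach v).
have depth_in v : v \in S -> v \in ball e r (depth v).
  by rewrite /depth; case: ex_minnP => m /implyP.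
have depth_min v m : v \in ball e r m -> depth v <= m.
  rewrite /depth; case: ex_minnP => i _ min_i vm.
  by apply: min_i; rewrite vm implybT.
(* The default [v] is never taken for a vertex of [S] other than [r]. *)
pose parent v := odflt v [pick w | e w v & depth w < depth v].
have parentP v : v \in S -> v != r ->
    e (parent v) v /\ depth (parent v) < depth v.
  move=> vS vr; rewrite /parent; case: pickP => [w /andP[] //|].
  suff [w ewv dwv] : exists2 w, e w v & depth w < depth v.
    by move/(_ w); rewrite ewv dwv.
  move: (vS) (depth_in v) (depth_min v) => /[swap] /[apply].
  case: (depth v) => [|m]; first by rewrite inE (negbTE vr).
  rewrite ballS => /orP[vm /(_ m vm)|/existsP[w /andP[wm ewv]] _].
    by rewrite ltnn.
  by exists w => //; apply: depth_min.
exists parent => [v vS vr|v w vS wS vr wr pv pw].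
  by have [] := parentP v vS vr.
have [_] := parentP v vS vr; have [_] := parentP w wS wr.
by rewrite pv pw => /ltn_trans /[apply]; rewrite ltnn.
Qed.

End Balls.

(** * Degrees, balls and blocks in the graph *)

Section Graph.
Variables (V : finType) (adj : rel V).
Hypothesis graph : simple_graph adj.

Let adjC u v : adj u v = adj v u. Proof. by case: graph. Qed.

Lemma degree_le v : degree adj v <= max_degree adj.
Proof. exact: leq_bigmax. Qed.

Lemma max_degree_gt0 : connected_graph adj -> 1 < #|V| -> 0 < max_degree adj.
Proof.
move=> conn /card_gt1P[u [v [_ _ uv]]].
have /connectP[[|w p] /= ep ev] := conn u v; first by rewrite ev eqxx in uv.
apply: leq_trans (degree_le u); apply/card_gt0P; exists w.
by rewrite inE; case/andP: ep.
Qed.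

Lemma card_ball u m : #|ball adj u m| <= expn (max_degree adj).+1 m.
Proof.
elim: m => [|m IH]; first by rewrite cards1.
rewrite expnS; apply: leq_trans (leq_mul (leqnn _) IH).
rewrite /ball iterS -/(ball adj u m) mulSn.
apply: leq_trans (leq_of_leqif (leq_card_setU _ _)) _; rewrite leq_add2l.
have sub : [set v | [exists w in ball adj u m, adj w v]] \subset
    \bigcup_(w in ball adj u m) [set v | adj w v].
  apply/subsetP=> v; rewrite inE => /existsP[w /andP[wB ewv]].
  by apply/bigcupP; exists w; rewrite // inE.
apply: leq_trans (subset_leq_card sub) _.
rewrite mulnC -sum_nat_const.
apply: leq_trans (_ : _ <= \sum_(w in ball adj u m) degree adj w) _; last first.
  by apply: leq_sum => w _; apply: degree_le.
elim/big_rec2: _ => [|w A d _ IHA]; first by rewrite cards0.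
by apply: leq_trans (leq_of_leqif (leq_card_setU _ _)) _; rewrite leq_add2l.
Qed.

(** A simple path inside [S] from [w] to [v] has fewer than [#|S|] edges, and the edge from [u] to
    [w] adds one. Applied to a block and its index [v], this turns counting the blocks adjacent to
    [u] into counting a ball around [u]. *)
Lemma block_boundary_ball (S : {set V}) u v w :
  v \in S -> induced_connected adj S -> w \in S -> adj w u ->
  v \in ball adj u #|S|.
Proof.
move=> vS conn wS wu; have /connectP[p ep ->] := conn w v wS vS.
case/shortenP: ep => p' ep up _.
have pS : {subset w :: p' <= S}.
  move=> x; rewrite inE => /orP[/eqP -> //|].
  elim: p' w ep {up wu wS} => //= y p' IH w /andP[/and3P[_ _ yS] /IH sub].
  by rewrite inE => /orP[/eqP -> //|].
have : size p' < #|S|.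
  by rewrite cardE; apply: (uniq_leq_size up) => x /pS; rewrite mem_enum.
move/(sub_ball adj u)/subsetP; apply.
have eup : path adj u (w :: p').
  rewrite /= adjC wu /=; apply: sub_path ep => x y.
  by case/and3P.
exact: (last_path_ball eup).
Qed.

Lemma edge_meetP (e A : {set V}) : e \in edges adj -> e :&: A != set0 ->
  exists x y, [/\ x \in A, adj x y & e = [set x; y]].
Proof.
rewrite inE => /existsP[x /existsP[y /andP[xy /eqP ->]]] /set0Pn[z].
rewrite !inE => /andP[/orP[]/eqP -> zA]; first by exists x, y.
by exists y, x; split; rewrite // 1?adjC // setUC.
Qed.

(** * Monochromatic edges meeting a vertex set *)

Section Configurations.
Variable q : nat.
Implicit Types (X Y : config V q) (S T e : {set V}).

(** Up to conversion [mu_block adj X c] is [mu_meet S (upd X c)]. Depending on the full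
    configuration only, this form allows the vertex set to vary. *)
Definition mu_meet S Y : nat :=
  #|[set e in edges adj | monochromatic Y e && (e :&: S != set0)]|.

Lemma monochromatic2 Y x y : monochromatic Y [set x; y] = (Y x == Y y).
Proof.
apply/forall_inP/eqP => [/(_ x)|xy u].
  rewrite !inE eqxx => /(_ isT) /forall_inP /(_ y).
  by rewrite !inE eqxx orbT => /(_ isT) /eqP.
move=> uxy; apply/forall_inP => w; move: uxy; rewrite !inE.
by move=> /orP[]/eqP -> /orP[]/eqP ->; rewrite ?xy eqxx.
Qed.

(* Each vertex of [T] other than [r] has a parent in a spanning tree of [S]
   rooted at [r], and the dart from it to its parent can be spared when each
   monochromatic edge meeting [T] is oriented out of a vertex of [T]: such an
   edge with both ends in [S] lies in [T], so it can be oriented the other way. *)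
Lemma mu_meet_color_class S T Y (a : 'I_q) r :
    induced_connected adj S -> r \in S ->
    T = [set v in S | Y v == a] ->
  mu_meet T Y + #|T :\ r| <= #|T| * max_degree adj.
Proof.
move=> conn rS defT.
have inT v : (v \in T) = (v \in S) && (Y v == a) by rewrite defT inE.
have TS v : v \in T -> v \in S by rewrite inT => /andP[].
have [p pP p_acyclic] := spanning_tree (fun v vS => conn r v rS vS).
pose D := [set d : V * V | (d.1 \in T) && adj d.1 d.2].
pose P := [set (v, p v) | v in T :\ r].
have cardD : #|D| <= #|T| * max_degree adj.
  rewrite -sum_nat_const -sum1_card.
  have -> : \sum_(d in D) 1 = \sum_(v in T) \sum_(w | adj v w) 1.
    by rewrite pair_big_dep /=; apply: eq_bigl => d; rewrite inE.
  apply: leq_sum => v _; rewrite sum1_card; apply: leq_trans (degree_le v).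
  by rewrite /degree cardsE.
have cardP : #|P| = #|T :\ r|.
  by rewrite card_in_imset // => v w _ _ [].
have PD : P \subset D.
  apply/subsetP=> _ /imsetP[v vTr ->]; rewrite !inE /=.
  case/setD1P: vTr => vr vT; rewrite vT adjC.
  by case/and3P: (pP v (TS v vT) vr).
rewrite -cardP; apply: leq_trans cardD; rewrite -(cardsID P D).
rewrite (setIidPr PD) addnC leq_add2l.
apply: leq_trans (leq_imset_card (fun d => [set d.1; d.2]) _).
apply/subset_leq_card/subsetP=> e; rewrite inE => /and3P[eE mono meet].
have [x [y [xT xy defe]]] := edge_meetP eE meet.
have [xyP|xyP] := boolP ((x, y) \in P); last first.
  by apply/imsetP; exists (x, y); rewrite //= in_setD xyP inE /= xT.
have /imsetP[x' /setD1P[xr _] [? pxy]] := xyP; subst x'.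
have yS : y \in S by case/and3P: (pP x (TS x xT) xr); rewrite pxy.
have yT : y \in T.
  rewrite inT yS /=; move: xT mono; rewrite defe monochromatic2 inT.
  by move=> /andP[_ /eqP ->] /eqP ->.
apply/imsetP; exists (y, x) => /=; last by rewrite setUC.
rewrite in_setD [in X in _ && X]inE /= yT adjC xy !andbT.
apply/imsetP => -[y' /setD1P[yr _] [? pyx]]; subst y'.
by apply: (p_acyclic x y (TS x xT) yS xr yr); rewrite -?pxy -?pyx.
Qed.

(** For a block [S] this relates a configuration to its possible updates on [S]; for [S = [set u]]
    it is Hamming distance at most one, with any difference at [u]. *)
Definition agree S X Y : bool := [forall v, (v \notin S) ==> (X v == Y v)].

Lemma agreeP S X Y : reflect (forall v, v \notin S -> X v = Y v) (agree S X Y).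
Proof.
by apply: (iffP forall_inP) => agr v vS; [apply/eqP|apply/eqP]; apply: agr.
Qed.

Lemma agree_sym S X Y : agree S X Y = agree S Y X.
Proof. by apply/agreeP/agreeP => agr v /agr. Qed.

Lemma agree_trans S X Y Z : agree S X Y -> agree S Y Z -> agree S X Z.
Proof.
by move=> /agreeP XY /agreeP YZ; apply/agreeP => v vS; rewrite XY ?YZ.
Qed.

Lemma agree_sub S T X Y : S \subset T -> agree S X Y -> agree T X Y.
Proof.
move=> /subsetP ST /agreeP XY; apply/agreeP => v vT.
by apply: XY; apply: contra vT => /ST.
Qed.

Lemma agree_upd S X (c : block_col q S) : agree S X (upd X c).
Proof.
by apply/agreeP => v vS; rewrite ffunE insubN.
Qed.

Lemma upd_out S X (c : block_col q S) v : v \notin S -> upd X c v = X v.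
Proof. by move=> vS; rewrite ffunE insubN. Qed.

Lemma upd_in S X (c : block_col q S) (x : {x | x \in S}) :
  upd X c (val x) = c x.
Proof. by rewrite ffunE valK. Qed.

Definition restr S Y : block_col q S := [ffun x => Y (val x)].

Lemma upd_restr S X Y : agree S X Y -> upd X (restr S Y) = Y.
Proof.
move=> /agreeP XY; apply/ffunP => v.
have [vS|vS] := boolP (v \in S); last by rewrite upd_out ?XY.
by rewrite -[v]/(val (exist (fun x => x \in S) v vS)) upd_in ffunE.
Qed.

Lemma restr_upd S X (c : block_col q S) : restr S (upd X c) = c.
Proof. by apply/ffunP => x; rewrite ffunE upd_in. Qed.

(** The bijection [upd X], with inverse [restr S], trades sums over the type [block_col q S], which
    depends on [S], for sums over configurations. *)
Lemma rsum_upd S X (F : config V q -> R) :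
  rsum (fun c : block_col q S => F (upd X c))
  = rsum (fun Y => if agree S X Y then F Y else 0%R).
Proof.
rewrite /rsum -big_mkcond (reindex (fun c : block_col q S => upd X c)) /=.
  by apply: eq_bigl => c; rewrite agree_upd.
exists (restr S) => [c _|Y]; first exact: restr_upd.
exact: upd_restr.
Qed.

Lemma rsum_agree_const S X (z : R) :
  rsum (fun Y => if agree S X Y then z else 0%R) = (INR q ^ #|S| * z)%R.
Proof.
rewrite -(rsum_upd S X (fun=> z)) rsum_const card_ffun card_sig card_ord.
have -> : #|[pred x in S]| = #|S| by apply: eq_card.
by congr (_ * _)%R; elim: #|S| => [//|m IH]; rewrite expnS -multE mult_INR IH.
Qed.

(* Edges avoiding [S] keep their colours. *)
Lemma mu_meet_agree S T X Y : agree S X Y -> S \subset T ->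
  mu_meet T X + mu_meet S Y = mu_meet T Y + mu_meet S X.
Proof.
move=> /agreeP XY ST.
have splitZ Z : mu_meet T Z = mu_meet S Z +
    #|[set e in edges adj | [&& monochromatic Z e, e :&: T != set0
                               & e :&: S == set0]]|.
  rewrite /mu_meet -(cardsID [set e | e :&: S != set0]); congr (_ + _).
    apply: eq_card => e; rewrite !inE -!andbA; congr (_ && (_ && _)).
    rewrite andb_idl // => /set0Pn[x]; rewrite inE => /andP[xe xS].
    by apply/set0Pn; exists x; rewrite inE xe (subsetP ST).
  apply: eq_card => e; rewrite !inE negbK.
  by rewrite andbC -!andbA.
rewrite !splitZ.
have -> : [set e in edges adj | [&& monochromatic X e, e :&: T != set0
                                  & e :&: S == set0]]
    = [set e in edges adj | [&& monochromatic Y e, e :&: T != set0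
                                  & e :&: S == set0]].
  apply/setP => e; rewrite !inE; congr (_ && _).
  have [eS|_] := boolP (e :&: S == set0); last by rewrite !andbF.
  rewrite !andbT; congr (_ && _).
  have XYe x : x \in e -> X x = Y x.
    move=> xe; apply: XY; apply/negP => xS; move/eqP/setP/(_ x): eS.
    by rewrite !inE xe xS.
  by apply/forall_inP/forall_inP => mono x xe; apply/forall_inP => y ye;
    have /forall_inP/(_ y ye) := mono x xe; rewrite !XYe.
lia.
Qed.

(** The root of the spanning tree can be chosen. If [T] is not all of [S], a root outside [T] spares
    one edge per vertex of [T]. If [T = S], the root spares none, and this single lost edge, spread
    over [#|S|] vertices, is the term [/ INR #|S|]. *)
Lemma mu_meet_color_class_le S T Y (a : 'I_q) :
    induced_connected adj S -> T = [set v in S | Y v == a] -> T != set0 ->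
  (INR (mu_meet T Y)
    <= (INR (max_degree adj) - 1 + / INR #|S|) * INR #|T|)%R.
Proof.
move=> conn defT /set0Pn[x xT].
have TS : T \subset S by apply/subsetP => v; rewrite defT inE => /andP[].
have xS := subsetP TS x xT.
have S0 : (0 < INR #|S|)%R by apply/lt_0_INR/ltP/card_gt0P; exists x.
have cardS := Rinv_0_lt_compat _ S0.
have [eqTS|neqTS] := eqVneq T S.
  have /leP/le_INR := mu_meet_color_class conn xS defT.
  have := cardsD1 x T; rewrite xT add1n => /(congr1 INR).
  rewrite -plusE -multE plus_INR mult_INR S_INR eqTS => cardT.
  suff : (/ INR #|S| * INR #|S| = 1)%R by lra.
  by apply/Rinv_l/Rgt_not_eq.
have [r rS rT] : exists2 r, r \in S & r \notin T.
  by apply/subsetPn; move: neqTS; rewrite eqEsubset TS.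
have /leP/le_INR := mu_meet_color_class conn rS defT.
have -> : T :\ r = T by apply/setDidPl; rewrite disjoint_sym disjoints1.
rewrite -plusE -multE plus_INR mult_INR => le1.
have := Rmult_le_pos _ _ (Rlt_le _ _ cardS) (pos_INR #|T|).
by lra.
Qed.

(** * Lipschitz functions for the Hamming distance *)

Local Open Scope R_scope.

(** The one-sided bound controls the absolute difference, because [agree] is symmetric. *)
Definition lipschitz (D : R) (f : config V q -> R) :=
  forall u X Y, agree [set u] X Y -> f X - f Y <= D.

Lemma lipschitz_agree D f S X Y :
  lipschitz D f -> agree S X Y -> f X - f Y <= INR #|S| * D.
Proof.
move=> lip; move: {2}#|S| (erefl #|S|) => m; elim: m S X => [|m IH] S X cardS.
  move/eqP: cardS; rewrite cards_eq0 => /eqP -> /agreeP XY.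
  have -> : X = Y by apply/ffunP => v; rewrite XY ?inE.
  by rewrite cards0 /=; lra.
have /card_gt0P[u uS] : (0 < #|S|)%nat by rewrite cardS.
move=> /agreeP XY.
(* [Z] corrects [X] at the single vertex [u]; the induction hypothesis covers the rest of [S]. *)
pose Z : config V q := [ffun v => if v == u then Y u else X v].
have XZ : agree [set u] X Z.
  by apply/agreeP => v; rewrite inE ffunE => /negbTE ->.
have ZY : agree (S :\ u) Z Y.
  apply/agreeP => v; rewrite !inE ffunE negb_and negbK; case: eqP => [-> //|_].
  exact: XY.
have := cardsD1 u S; rewrite uS add1n => cardSu.
have := IH (S :\ u) Z _ ZY; rewrite cardSu S_INR => /(_ _) le1.
have := le1 (succn_inj (etrans (esym cardSu) cardS)).
by have := lip u X Z XZ; lra.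
Qed.

Definition expect (P : config V q -> config V q -> R) f X :=
  rsum (fun Y => P X Y * f Y).

(** * Peierls bounds for the conditional law on a block *)

Section Weights.
Variable lam : R.
Hypothesis lam_gt1 : 1 < lam.

Definition block_sum S X :=
  rsum (fun c : block_col q S => lam ^ mu_block adj X c).

Let lam_pow_gt0 m : 0 < lam ^ m. Proof. by apply: pow_lt; lra. Qed.

Lemma block_sumE S X :
  block_sum S X = rsum (fun Y => if agree S X Y then lam ^ mu_meet S Y else 0).
Proof. exact: (rsum_upd S X (fun Y => lam ^ mu_meet S Y)). Qed.

Lemma block_sum_gt0 S X : 0 < block_sum S X.
Proof. by apply: (rsum_pos (restr S X)) => c. Qed.

(** The Peierls factor per vertex of a colour class: the edge weight lost by recolouring it, against
    the [q] colours it may then take. *)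
Definition activity S :=
  Rpower lam (INR (max_degree adj) - 1 + / INR #|S|) / INR q.

(* A Peierls argument: recolouring the colour class [T] arbitrarily destroys a
   controlled number of monochromatic edges and yields [q ^ #|T|]
   configurations, from each of which the original one can be recovered. *)
Lemma color_class_weight S T X (a : 'I_q) :
    induced_connected adj S -> T != set0 ->
  rsum (fun Y => if agree S X Y && ([set v in S | Y v == a] == T)
                 then lam ^ mu_meet S Y else 0)
    <= activity S ^ #|T| * block_sum S X.
Proof.
move=> conn T0.
have q0 : 0 < INR q by apply/lt_0_INR/ltP; case: (a) => m; apply: leq_ltn_trans.
have qT0 : 0 < INR q ^ #|T| by apply: pow_lt.
pose cls Y := agree S X Y && ([set v in S | Y v == a] == T).
pose L := Rpower lam (INR (max_degree adj) - 1 + / INR #|S|) ^ #|T|.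
have L0 : 0 < L by apply/pow_lt/exp_pos.
have recolour Y Y' : cls Y -> agree T Y Y' ->
    agree S X Y' /\ lam ^ mu_meet S Y <= L * lam ^ mu_meet S Y'.
  move=> /andP[XY /eqP/esym defT] YY'.
  have TS : T \subset S by apply/subsetP => v; rewrite defT inE => /andP[].
  split; first exact: agree_trans XY (agree_sub TS YY').
  have le_mu : (mu_meet S Y <= mu_meet T Y + mu_meet S Y')%nat.
    by have := mu_meet_agree YY' TS; lia.
  apply: Rle_trans (_ : lam ^ (mu_meet T Y + mu_meet S Y') <= _).
    by apply: Rle_pow; [lra | apply/leP].
  rewrite pow_add; apply: Rmult_le_compat_r; first exact/Rlt_le.
  rewrite /L -!Rpower_pow; [|exact: exp_pos|lra].
  rewrite Rpower_mult; apply: Rle_Rpower; first exact: Rlt_le.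
  exact: mu_meet_color_class_le conn defT T0.
have unique Y' Y1 Y2 : cls Y1 && agree T Y1 Y' -> cls Y2 && agree T Y2 Y' ->
    Y1 = Y2.
  move=> /andP[/andP[_ /eqP/setP cls1] /agreeP agr1].
  move=> /andP[/andP[_ /eqP/setP cls2] /agreeP agr2].
  apply/ffunP => v; have [vT|vT] := boolP (v \in T); last by rewrite agr1 ?agr2.
  move: (cls1 v) (cls2 v); rewrite vT !inE.
  by move=> /andP[_ /eqP ->] /andP[_ /eqP ->].
suff bound : INR q ^ #|T| *
    rsum (fun Y => if cls Y then lam ^ mu_meet S Y else 0) <= L * block_sum S X.
  rewrite /activity /Rdiv Rpow_mult_distr pow_inv -/L.
  apply: (Rmult_le_reg_l (INR q ^ #|T|)) => //.
  by apply: Rle_trans bound _; right; field; lra.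
rewrite -rsum_mull block_sumE -rsum_mull.
(* Double counting of pairs: each [Y] with class [T] has [q ^ #|T|] recolourings [Y'], and each [Y']
   arises from at most one [Y]. *)
apply: Rle_trans (_ : rsum (fun Y => rsum (fun Y' =>
  if cls Y && agree T Y Y' then
    L * (if agree S X Y' then lam ^ mu_meet S Y' else 0) else 0)) <= _).
  apply: rsum_le => Y; case: ifPn => [clsY|_] /=; last first.
    by rewrite Rmult_0_r; right; rewrite rsum_const Rmult_0_r.
  rewrite -(rsum_agree_const T Y); apply: rsum_le => Y'.
  case: ifPn => [YY'|_]; last by right.
  by have [-> le_w] := recolour Y Y' clsY YY'.
rewrite rsum_exchange; apply: rsum_le => Y'.
set w := L * _; have w0 : 0 <= w.
  by apply: Rmult_le_pos; [lra | case: ifP => _; [exact: Rlt_le | right]].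
case: (pickP (fun Y => cls Y && agree T Y Y')) => [Y0 clsY0|none].
  apply: Rle_trans (_ : rsum (fun Y => if Y == Y0 then w else 0) <= _).
    apply: rsum_le => Y; case: ifP => [clsY|_].
      by rewrite (unique _ _ _ clsY clsY0) eqxx; right.
    by case: ifP => _; lra.
  by right; apply: rsum_delta.
rewrite (@eq_rsum _ _ (fun=> 0)) => [|Y]; last by rewrite none.
by rewrite rsum_const Rmult_0_r.
Qed.

(** Union bound over the nonempty colour classes [T] inside [S]: at most [2 ^ #|S|] of them, each of
    relative weight at most [activity S ^ #|T|], hence at most [activity S] since this is at most
    1. *)
Lemma color_used_weight S X (a : 'I_q) :
    induced_connected adj S -> activity S <= 1 ->
  rsum (fun c : block_col q S =>
          if [exists x, c x == a] then lam ^ mu_block adj X c else 0)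
    <= 2 ^ #|S| * activity S * block_sum S X.
Proof.
move=> conn act1.
have act0 : 0 <= activity S.
  rewrite /activity; apply: Rmult_le_pos; first exact/Rlt_le/exp_pos.
  apply/Rlt_le/Rinv_0_lt_compat/lt_0_INR/ltP.
  by case: (a) => m; apply: leq_ltn_trans.
pose cls Y := [set v in S | Y v == a].
pose used_wt Y := if cls Y != set0 then lam ^ mu_meet S Y else 0.
rewrite (@eq_rsum _ _ (fun c : block_col q S => used_wt (upd X c))); last first.
  move=> c; congr (if _ then _ else _); apply/existsP/set0Pn => [[x /eqP cx]|[v]].
    by exists (val x); rewrite inE upd_in cx eqxx (valP x).
  rewrite inE => /andP[vS]; rewrite -[v]/(val (exist (fun x => x \in S) v vS)).
  by rewrite upd_in; exists (exist _ v vS).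
rewrite rsum_upd /used_wt.
(* The sum is partitioned according to the class [T] of the colour [a]. *)
rewrite (@eq_rsum _ _ (fun Y => rsum (fun T => if T == cls Y then
  (if T != set0 then if agree S X Y then lam ^ mu_meet S Y else 0 else 0)
  else 0))); last first.
  by move=> Y /=; rewrite rsum_delta; do 2 case: ifP => _.
rewrite rsum_exchange.
apply: Rle_trans (_ : rsum (fun T : {set V} =>
   (if T \in powerset S then 1 else 0) * (activity S * block_sum S X)) <= _); last first.
  rewrite rsum_mulr rsum_card card_powerset.
  have -> : INR (expn 2 #|S|) = 2 ^ #|S|.
    by elim: #|S| => [//|m IH]; rewrite expnS -multE mult_INR IH.
  by right; ring.
have ab0 : 0 <= activity S * block_sum S X.
  by apply: Rmult_le_pos => //; apply/Rlt_le/block_sum_gt0.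
apply: rsum_le => T.
case: (boolP ((T \subset S) && (T != set0))) => [/andP[TS T0]|].
  rewrite powersetE TS Rmult_1_l.
  rewrite (@eq_rsum _ _ (fun Y => if agree S X Y && (cls Y == T)
     then lam ^ mu_meet S Y else 0)); last first.
    move=> Y; rewrite T0 [T == _]eq_sym andbC; by case: (_ == T).
  apply: Rle_trans (color_class_weight X a conn T0) _.
  apply: Rmult_le_compat_r; first exact/Rlt_le/block_sum_gt0.
  have /card_gt0P/prednK <- : exists x, x \in T by apply/set0Pn.
  rewrite -tech_pow_Rmult -[X in _ <= X]Rmult_1_r.
  apply: Rmult_le_compat_l => //.
  by rewrite -(pow1 #|T|.-1); apply: pow_incr.
rewrite negb_and negbK => notT.
rewrite (@eq_rsum _ _ (fun=> 0)) ?rsum_const ?Rmult_0_r => [|Y].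
  by case: ifP => _; lra.
case: eqP => // defT; case/orP: notT => [|/eqP ->]; last by rewrite eqxx.
by rewrite defT; case/negP; apply/subsetP => v; rewrite inE => /andP[].
Qed.

(** * One block update from two configurations differing at a single vertex *)

Lemma agree_upd2 T S X Y (c : block_col q S) :
  agree T X Y -> agree T (upd X c) (upd Y c).
Proof.
move=> /agreeP XY; apply/agreeP => v vT; rewrite !ffunE.
by case: insubP => // _; apply: XY.
Qed.

(** Only edges between [S] and [u] see the difference of [X] and [Y], and under the last hypothesis
    none of these is monochromatic for [X]. *)
Lemma mu_block_le S X Y (c : block_col q S) u :
    u \notin S -> agree [set u] X Y ->
    (forall w, w \in S -> adj w u -> upd X c w <> X u) ->
  (mu_block adj X c <= mu_block adj Y c)%nat.
Proof.
move=> uS XY unused; apply/subset_leq_card/subsetP => e.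
rewrite inE => /and3P[eE mono meet]; rewrite inE eE meet andbT /=.
have [x [y [xS xy defe]]] := edge_meetP eE meet.
move: mono; rewrite defe !monochromatic2.
have /agreeP agr := agree_upd2 c XY.
have xu : x \notin [set u] by rewrite inE; apply: contraNneq uS => <-.
have [yu|yu] := eqVneq y u.
  rewrite yu in xy *; rewrite (upd_out X c uS) => /eqP.
  by move/(unused x xS xy).
by rewrite !agr // inE.
Qed.

Definition block_prob S X (c : block_col q S) :=
  lam ^ mu_block adj X c / block_sum S X.

Lemma block_prob_ge0 S X (c : block_col q S) : 0 <= block_prob X c.
Proof. by apply/Rlt_le/Rdiv_lt_0_compat => //; apply: block_sum_gt0. Qed.

Lemma rsum_block_prob S X : rsum (fun c : block_col q S => block_prob X c) = 1.
Proof.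
rewrite /block_prob /Rdiv rsum_mulr -/(block_sum S X); apply: Rinv_r.
by have := block_sum_gt0 S X; lra.
Qed.

Lemma block_prob_l1_dist S X Y u :
    u \notin S -> agree [set u] X Y -> induced_connected adj S ->
    activity S <= 1 ->
  rsum (fun c : block_col q S => Rabs (block_prob X c - block_prob Y c))
    <= 2 * (2 ^ #|S| * activity S).
Proof.
move=> uS XY conn act1.
(* [normalised_l1_dist] needs the larger normaliser on the side whose colour at [u] defines the
   exceptional set. *)
wlog leZ : X Y XY / block_sum S Y <= block_sum S X.
  move=> th; case: (Rle_dec (block_sum S Y) (block_sum S X)); first exact: th.
  move=> /Rnot_le_lt/Rlt_le leZ.
  rewrite (@eq_rsum _ _ (fun c : block_col q S =>
    Rabs (block_prob Y c - block_prob X c))) => [|c]; last exact: Rabs_minus_sym.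
  by apply: th; rewrite // agree_sym.
apply: Rle_trans (normalised_l1_dist (B := fun c : block_col q S =>
  [exists x, c x == X u]) _ _ _ _) _ => [c|c||c|].
- exact: Rlt_le.
- exact: Rlt_le.
- by split=> //; apply: block_sum_gt0.
- move=> unused; apply: Rle_pow; first lra.
  apply/leP/(mu_block_le uS XY) => w wS _ cw; case/existsP: unused.
  exists (exist _ w wS); rewrite -cw.
  by rewrite -[X in upd _ _ X]/(val (exist (fun x => x \in S) w wS)) upd_in.
apply: Rmult_le_compat_l; first lra.
have ZX := block_sum_gt0 S X.
apply: (Rmult_le_reg_r (block_sum S X)) => //.
rewrite -/(block_sum S X) /Rdiv Rmult_assoc Rinv_l ?Rmult_1_r; last by lra.
exact: color_used_weight.
Qed.

Definition block_mean S X (f : config V q -> R) :=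
  rsum (fun c : block_col q S => block_prob X c * f (upd X c)).

Lemma block_mean_const S X z : block_mean S X (fun=> z) = z.
Proof. by rewrite /block_mean rsum_mulr rsum_block_prob Rmult_1_l. Qed.

(** Using the same [c] on both sides costs at most [D]. The change of law is then tested against a
    function whose oscillation is at most [INR #|S| * D], as two updates of [Y] differ only on
    [S]. *)
Lemma block_mean_sub_le S X Y u D f :
    agree [set u] X Y -> lipschitz D f ->
  block_mean S X f - block_mean S Y f <= D + INR #|S| * D *
    rsum (fun c : block_col q S => Rabs (block_prob X c - block_prob Y c)).
Proof.
move=> XY lip; pose g (c : block_col q S) := f (upd Y c).
pose c0 := restr S Y.
have -> : block_mean S X f - block_mean S Y f =
    rsum (fun c : block_col q S => block_prob X c * (f (upd X c) - f (upd Y c)))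
    + rsum (fun c => (block_prob X c - block_prob Y c) * (g c - g c0)).
  rewrite -rsum_add /block_mean.
  (* Each 1 becomes the total mass of one of the two laws, so that [g c0] can be subtracted under
     the sum. *)
  have -> : forall a b, a - b = a - b - g c0 * (1 - 1) by move=> a b; lra.
  rewrite -{1}(rsum_block_prob S X) -(rsum_block_prob S Y).
  rewrite -!rsum_sub -rsum_mull -rsum_sub.
  by apply: eq_rsum => c; rewrite /g; ring.
apply: Rplus_le_compat.
  apply: Rle_trans (_ : rsum (fun c : block_col q S => block_prob X c * D) <= _).
    apply: rsum_le => c; apply: Rmult_le_compat_l; first exact: block_prob_ge0.
    by apply: lip; apply: agree_upd2 XY.
  by rewrite rsum_mulr rsum_block_prob; lra.
rewrite -rsum_mull; apply: rsum_le => c.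
apply: Rle_trans (Rle_abs _) _; rewrite Rabs_mult Rmult_comm.
apply: Rmult_le_compat_r; first exact: Rabs_pos.
have agr c1 c2 : agree S (@upd V q Y S c1) (@upd V q Y S c2).
  by rewrite (agree_trans _ (agree_upd Y c2)) // agree_sym agree_upd.
have := lipschitz_agree lip (agr c c0); have := lipschitz_agree lip (agr c0 c).
by rewrite -/(g c) -/(g c0) => le1 le2; apply: Rabs_le; lra.
Qed.

(** The update overwrites [u], the only place where [X] and [Y] can differ. *)
Lemma block_mean_inside S X Y u f :
  u \in S -> agree [set u] X Y -> block_mean S X f = block_mean S Y f.
Proof.
move=> uS XY.
have eq_upd (c : block_col q S) : upd X c = upd Y c.
  rewrite -[LHS](upd_restr (S := S) (X := Y)) ?restr_upd //.
  apply: agree_trans (agree_upd X c); rewrite agree_sym.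
  by apply: agree_sub XY; rewrite sub1set.
have eq_mu (c : block_col q S) : mu_block adj X c = mu_block adj Y c.
  by rewrite /mu_block eq_upd.
have eqZ : block_sum S X = block_sum S Y.
  by apply: eq_rsum => c; rewrite eq_mu.
by apply: eq_rsum => c; rewrite /block_prob eq_mu eqZ eq_upd.
Qed.

(** No edge joins [S] to [u], so [mu_block_le] holds in both directions and the two conditional laws
    coincide. *)
Lemma block_mean_far S X Y u D f :
    u \notin S -> (forall w, w \in S -> ~~ adj w u) ->
    agree [set u] X Y -> lipschitz D f ->
  block_mean S X f - block_mean S Y f <= D.
Proof.
move=> uS far XY lip.
have eq_mu (c : block_col q S) : mu_block adj X c = mu_block adj Y c.
  apply/eqP; rewrite eqn_leq; apply/andP; split; apply: mu_block_le uS _ _.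
  - exact: XY.
  - by move=> w /far /negbTE ->.
  - by rewrite agree_sym.
  - by move=> w /far /negbTE ->.
have eqZ : block_sum S X = block_sum S Y.
  by apply: eq_rsum => c; rewrite eq_mu.
have := block_mean_sub_le S XY lip.
rewrite (@eq_rsum _ _ (fun=> 0)) => [|c]; first by rewrite rsum_const; lra.
by rewrite /block_prob eq_mu eqZ Rminus_diag Rabs_R0.
Qed.

(** * Reversibility, stationarity and contraction of the block dynamics *)

Lemma block_updateE S X Y : block_update adj lam X S Y =
  (if agree S X Y then lam ^ mu_meet S Y else 0) / block_sum S X.
Proof.
congr (_ / _).
rewrite -[RHS](rsum_delta Y (fun Y =>
  if agree S X Y then lam ^ mu_meet S Y else 0)).
rewrite (@eq_rsum _ _ (fun Y' => if agree S X Y' then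
  (if Y' == Y then lam ^ mu_meet S Y' else 0) else 0)); last first.
  by move=> Y'; case: ifP; case: ifP.
by rewrite -(rsum_upd S X (fun Y' => if Y' == Y then lam ^ mu_meet S Y' else 0)).
Qed.

Lemma rsum_block_update S X f :
  rsum (fun Y => block_update adj lam X S Y * f Y) = block_mean S X f.
Proof.
rewrite /block_mean /block_prob.
rewrite (rsum_upd S X (fun Y => lam ^ mu_meet S Y / block_sum S X * f Y)).
apply: eq_rsum => Y; rewrite block_updateE /Rdiv.
by case: ifP => _; ring.
Qed.

(** Detailed balance block by block: configurations agreeing off [S] share the normaliser
    [block_sum], and edges avoiding [S] cancel. *)
Lemma gibbs_reversible S X Y :
  gibbs adj q lam X * block_update adj lam X S Y
  = gibbs adj q lam Y * block_update adj lam Y S X.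
Proof.
rewrite !block_updateE agree_sym; case: ifPn => [YX|_]; last first.
  by rewrite /Rdiv; ring.
have -> : block_sum S X = block_sum S Y.
  rewrite !block_sumE; apply: eq_rsum => Z; congr (if _ then _ else _).
  apply/idP/idP; apply: agree_trans; first exact: YX.
  by rewrite agree_sym.
(* Every edge is nonempty, hence meets [setT]; this makes [mu_meet_agree] applicable to [mu]. *)
have muE Z : mu adj Z = mu_meet setT Z.
  apply: eq_card => e; rewrite [in LHS]inE [in RHS]inE setIT.
  have [eE|//] := boolP (e \in edges adj).
  suff -> : e != set0 by rewrite andbT.
  move: eE; rewrite inE => /existsP[x /existsP[y /andP[_ /eqP ->]]].
  by apply/set0Pn; exists x; rewrite !inE eqxx.
have XY : agree S X Y by rewrite agree_sym.
have := congr1 (pow lam) (mu_meet_agree XY (subsetT S)).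
rewrite -!muE !pow_add /gibbs /Rdiv => eq_pow.
set w := / rsum _; set z := / block_sum S Y.
transitivity (w * z * (lam ^ mu adj X * lam ^ mu_meet S Y)); first by ring.
by rewrite eq_pow; ring.
Qed.

Variable Sys : V -> {set V}.

Lemma expect_BD f X :
  expect (BD adj q lam Sys) f X
  = rsum (fun v => / INR #|V| * block_mean (Sys v) X f).
Proof.
rewrite /expect /BD (@eq_rsum _ _ (fun Y => rsum (fun v =>
  / INR #|V| * block_update adj lam X (Sys v) Y * f Y))) => [|Y]; last first.
  by rewrite rsum_mulr.
rewrite rsum_exchange; apply: eq_rsum => v.
by rewrite -rsum_block_update -rsum_mull; apply: eq_rsum => Y; ring.
Qed.

Lemma gibbs_stationary f : (0 < #|V|)%nat ->
  rsum (fun X => gibbs adj q lam X * expect (BD adj q lam Sys) f X)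
  = rsum (fun X => gibbs adj q lam X * f X).
Proof.
move=> V0; have n0 : 0 < INR #|V| by apply/lt_0_INR/ltP.
(* Inserting the row sum 1 turns the right side into a double sum too, and reversibility matches the
   two term by term. *)
transitivity (rsum (fun Y => gibbs adj q lam Y
    * expect (BD adj q lam Sys) (fun=> 1) Y * f Y)); last first.
  apply: eq_rsum => Y; rewrite expect_BD.
  rewrite (@eq_rsum _ _ (fun=> / INR #|V|)) => [|v].
    by rewrite rsum_const Rinv_r ?Rmult_1_r //; lra.
  by rewrite block_mean_const Rmult_1_r.
transitivity (rsum (fun X => rsum (fun Y =>
    gibbs adj q lam X * (BD adj q lam Sys X Y * f Y)))).
  by apply: eq_rsum => X; rewrite rsum_mull.
rewrite rsum_exchange; apply: eq_rsum => Y.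
rewrite /expect Rmult_assoc Rmult_comm -rsum_mulr Rmult_comm -rsum_mull.
apply: eq_rsum => X; rewrite Rmult_1_r -!Rmult_assoc; congr (_ * f Y).
rewrite /BD -!rsum_mull; apply: eq_rsum => v.
have := gibbs_reversible (Sys v) X Y.
set g := gibbs _ _ _ _; set g' := gibbs _ _ _ _ => rev.
transitivity (/ INR #|V| * (g * block_update adj lam X (Sys v) Y)); first by ring.
by rewrite rev; ring.
Qed.

Lemma expect_BD_lipschitz k D A f :
    block_system adj k Sys -> (forall v, activity (Sys v) = A) -> 0 <= A <= 1 ->
    INR (expn (max_degree adj).+1 k) * (INR k * (2 * (2 ^ k * A))) <= / 4 ->
    0 <= D -> lipschitz D f ->
  lipschitz ((1 - 3 / 4 / INR #|V|) * D) (expect (BD adj q lam Sys) f).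
Proof.
move=> blocks actA [A0 A1] small D0 lip u X Y XY.
have n0 : 0 < INR #|V| by apply/lt_0_INR/ltP/card_gt0P; exists u.
rewrite !expect_BD -rsum_sub.
(* The extra cost of an adjacent block in units of [D]: the size of the block times the l1 distance
   of the two conditional laws. *)
set kap := INR k * (2 * (2 ^ k * A)).
have kap0 : 0 <= kap.
  have pow2 : 0 <= 2 ^ k by apply: pow_le; lra.
  apply: Rmult_le_pos; first exact: pos_INR.
  by apply: Rmult_le_pos; [lra | apply: Rmult_le_pos].
have Dkap : 0 <= D * kap by apply: Rmult_le_pos.
(* A gain is claimed only for the block indexed by [u], which contains [u]; the surcharge is allowed
   on the whole ball, which contains the index of every block adjacent to [u] but not containing
   it. *)
have step v : block_mean (Sys v) X f - block_mean (Sys v) Y f <=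
    D - (if v == u then D else 0)
    + (if v \in ball adj u k then 1 else 0) * (D * kap).
  have [vS cardS conn] := blocks v.
  have ball_term : 0 <= (if v \in ball adj u k then 1 else 0) * (D * kap).
    by case: ifP => _; lra.
  have [uS|uS] := boolP (u \in Sys v).
    by rewrite (block_mean_inside f uS XY); case: ifP => _; lra.
  have -> : (v == u) = false by apply: contraNF uS => /eqP <-.
  have [near|far] := boolP [exists w in Sys v, adj w u]; last first.
    suff : block_mean (Sys v) X f - block_mean (Sys v) Y f <= D by lra.
    apply: block_mean_far uS _ XY lip => w wS.
    by apply: contra far => wu; apply/existsP; exists w; rewrite wS.
  have /existsP[w /andP[wS wu]] := near.
  rewrite -{1}cardS (block_boundary_ball vS conn wS wu).
  apply: Rle_trans (block_mean_sub_le (Sys v) XY lip) _.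
  have := block_prob_l1_dist uS XY conn; rewrite actA cardS => /(_ A1) l1.
  have kD0 : 0 <= INR k * D by apply: Rmult_le_pos => //; apply: pos_INR.
  by have := Rmult_le_compat_l _ _ _ kD0 l1; rewrite /kap; lra.
have le_sum : rsum (fun v => block_mean (Sys v) X f - block_mean (Sys v) Y f)
    <= INR #|V| * D - D + / 4 * D.
  apply: Rle_trans (rsum_le step) _.
  rewrite rsum_add rsum_sub rsum_const rsum_mulr rsum_card.
  rewrite (rsum_delta u (fun=> D)).
  have /leP/le_INR := card_ball u k => le_ball.
  have := Rmult_le_compat_r _ _ _ Dkap le_ball.
  by have := Rmult_le_compat_r _ _ _ D0 small; rewrite -/kap; lra.
rewrite (@eq_rsum _ _ (fun v => / INR #|V| *
  (block_mean (Sys v) X f - block_mean (Sys v) Y f))) => [|v]; last by ring.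
rewrite rsum_mull.
apply: Rle_trans (Rmult_le_compat_l _ _ _ _ le_sum) _.
  exact/Rlt_le/Rinv_0_lt_compat.
by right; field; lra.
Qed.

End Weights.
End Configurations.
End Graph.

(** * From contraction of Lipschitz constants to total variation *)

Section Mixing.
Local Open Scope R_scope.
Variables (V : finType) (q : nat) (P : config V q -> config V q -> R).

Lemma rsum_step_dist x t f :
  rsum (fun y => step_dist P x t y * f y) = iter t (expect P) f x.
Proof.
elim: t f => [|t IH] f.
  rewrite /= -(rsum_delta x f); apply: eq_rsum => y.
  by case: ifP => _; ring.
rewrite iterSr -IH /=.
rewrite (@eq_rsum _ _ (fun y => rsum (fun z => step_dist P x t z * P z y * f y)))
  => [|y]; last by rewrite rsum_mulr.
rewrite rsum_exchange; apply: eq_rsum => z.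
by rewrite /expect -rsum_mull; apply: eq_rsum => y; ring.
Qed.

Variables (pi : config V q -> R) (rate : R).
Hypotheses (pi_ge0 : forall x, 0 <= pi x) (pi_sum : rsum pi = 1).
Hypothesis pi_stationary : forall f,
  rsum (fun x => pi x * expect P f x) = rsum (fun x => pi x * f x).
Hypothesis rate_ge0 : 0 <= rate.
Hypothesis contraction : forall D f,
  0 <= D -> lipschitz D f -> lipschitz (rate * D) (expect P f).

(* The dual form of path coupling: contraction of the Lipschitz constant with
   respect to the Hamming distance, whose diameter is [#|V|]. *)
Lemma tv_dist_lipschitz_contraction x t :
  tv_dist (step_dist P x t) pi <= INR #|V| * rate ^ t.
Proof.
(* The sign of the difference is the test function attaining the l1 norm; its oscillation is at most
   2. *)
pose s y := if Rle_dec (pi y) (step_dist P x t y) then 1 else -1.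
have s_lip : lipschitz 2 s.
  by move=> u X Y _; rewrite /s;
    case: Rle_dec => ? /=; case: Rle_dec => ? /=; lra.
have [iter_lip rate_t] : lipschitz (rate ^ t * 2) (iter t (expect P) s)
    /\ 0 <= rate ^ t.
  split; last exact: pow_le.
  elim: {s}t s s_lip => [|t IH] s s_lip; first by rewrite Rmult_1_l.
  rewrite iterS /= Rmult_assoc; apply: contraction; last exact: IH.
  by apply: Rmult_le_pos; [apply: pow_le | lra].
have iter_stat : rsum (fun y => pi y * iter t (expect P) s y)
    = rsum (fun y => pi y * s y).
  by elim: (t) (s) => [//|m IH] f; rewrite iterS pi_stationary.
have -> : tv_dist (step_dist P x t) pi = / 2 *
    (rsum (fun y => step_dist P x t y * s y) - rsum (fun y => pi y * s y)).
  rewrite /tv_dist -rsum_sub; congr (_ * _); apply: eq_rsum => y.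
  rewrite /s; case: Rle_dec => [le|gt] /=; first by rewrite Rabs_right; lra.
  by have lt := Rnot_le_lt _ _ gt; rewrite Rabs_left; lra.
rewrite rsum_step_dist -iter_stat; set g := iter t _ s.
(* Writing [g x] as an average under [pi] leaves only differences [g x - g y], bounded by the
   diameter times the Lipschitz constant. *)
have -> : g x = rsum (fun y => pi y * g x) by rewrite rsum_mulr pi_sum; lra.
rewrite -rsum_sub.
apply: Rle_trans (_ : / 2 * rsum (fun y => pi y * (INR #|V| * (rate ^ t * 2))) <= _).
  apply: Rmult_le_compat_l; first lra.
  apply: rsum_le => y; rewrite -Rmult_minus_distr_l.
  apply: Rmult_le_compat_l => //; rewrite -cardsT.
  by apply: lipschitz_agree iter_lip _; apply/agreeP => v; rewrite inE.
by rewrite rsum_mulr pi_sum; lra.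
Qed.

End Mixing.

(** * Numerical estimates *)

Section Numerics.
Local Open Scope R_scope.

(** With [M = (d k) ^ k] and [w = 2 ^ k * k * A] the hypothesis reads [M * M * (2 * w) <= 1]. One
    factor [M] dominates the ball size, as [d + 1 <= d k]; the other is at least 4, as [k >= 2]. *)
Lemma neighbourhood_size_le (k d : nat) (A : R) :
    (2 <= k)%nat -> (0 < d)%nat ->
    2 ^ (k + 1) * INR d ^ (2 * k) * INR k ^ (2 * k + 1) * A <= 1 -> 0 <= A ->
  INR (expn d.+1 k) * (INR k * (2 * (2 ^ k * A))) <= / 4.
Proof.
move=> k2 d0; rewrite !mul2n -!addnn !pow_add !pow_1 => le1 A0.
have k2' : 2 <= INR k by have /leP/le_INR := k2.
have d1 : 1 <= INR d by have /leP/le_INR := d0.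
have le_ball : INR (expn d.+1 k) <= INR d ^ k * INR k ^ k.
  have -> : INR (expn d.+1 k) = INR d.+1 ^ k.
    by elim: (k) => [//|m IH]; rewrite expnS -multE mult_INR IH.
  rewrite -Rpow_mult_distr; apply: pow_incr; rewrite S_INR; nra.
have four_le : 4 <= INR d ^ k * INR k ^ k.
  rewrite -Rpow_mult_distr; apply: Rle_trans (_ : 2 ^ k <= _).
    have -> : 4 = 2 ^ 2 by ring.
    by apply: Rle_pow; [lra | apply/leP].
  by apply: pow_incr; nra.
set N := INR _ in le_ball *; set M := INR d ^ k * INR k ^ k in le_ball four_le.
have {}le1 : M * M * (2 * (2 ^ k * INR k * A)) <= 1.
  by apply: Rle_trans le1; right; rewrite /M; ring.
have w0 : 0 <= 2 ^ k * INR k * A.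
  have pow2 : 0 <= 2 ^ k by apply: pow_le; lra.
  by apply: Rmult_le_pos => //; apply: Rmult_le_pos; lra.
set w := 2 ^ k * INR k * A in le1 w0.
have -> : N * (INR k * (2 * (2 ^ k * A))) = N * (2 * w) by rewrite /w; ring.
have : N * (2 * w) <= M * (2 * w) by apply: Rmult_le_compat_r; lra.
have Mw0 : 0 <= M * (2 * w) by apply: Rmult_le_pos; lra.
have : 4 * (M * (2 * w)) <= M * (M * (2 * w)) by apply: Rmult_le_compat_r.
lra.
Qed.

(* Rounding down to an integer costs less than one step, which the slack
   between the rates [3 / (4 n)] and [1 / (2 n)] absorbs. *)
Lemma contraction_time (n eps : R) : 3 <= n -> 0 < eps < 1 ->
  exists t : nat, INR t <= 2 * n * ln (n / eps) /\
    n * (1 - 3 / 4 / n) ^ t <= eps.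
Proof.
move=> n3 [eps0 eps1]; set l := ln (n / eps).
have ieps : 1 <= / eps by rewrite -Rinv_1; apply: Rinv_le_contravar; lra.
(* Here [n / eps >= 3 >= exp 1]. The slack [l / 2] in the exponent then exceeds the rounding loss
   [3 / (4 n)], which is at most 1/4. *)
have l1 : 1 <= l.
  apply: Rnot_lt_le => /exp_increasing; rewrite exp_ln.
    by have := exp_le_3; rewrite /Rdiv; nra.
  by apply: Rdiv_lt_0_compat; lra.
have in0 : 0 < / n by apply: Rinv_0_lt_compat; lra.
have n_in : n * / n = 1 by apply: Rinv_r; lra.
have [|t [tT Tt]] := exists_nat_floor (T := 2 * n * l).
  by apply: Rmult_le_pos; lra.
exists t; split=> //.
have pow_le_exp : (1 - 3 / 4 / n) ^ t <= exp (INR t * - (3 / 4 / n)).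
  rewrite exp_scale; apply: pow_incr; split; first by rewrite /Rdiv; nra.
  by have := exp_ineq1_le (- (3 / 4 / n)); lra.
apply: Rle_trans (Rmult_le_compat_l n _ _ _ pow_le_exp) _; first lra.
apply: Rle_trans (_ : n * exp (- l) <= _); last first.
  rewrite exp_Ropp exp_ln; last by apply: Rdiv_lt_0_compat; lra.
  by right; field; lra.
apply: Rmult_le_compat_l; first lra.
suff exp_le : INR t * - (3 / 4 / n) <= - l.
  by case: exp_le => [/exp_increasing/Rlt_le //|->]; right.
have in3 : / n <= / 3 by apply: Rinv_le_contravar; lra.
have : (2 * n * l - 1) * / n <= INR t * / n by apply: Rmult_le_compat_r; lra.
have -> : (2 * n * l - 1) * / n = 2 * l * (n * / n) - / n by ring.
by rewrite n_in /Rdiv; lra.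
Qed.

End Numerics.

(** * Combining contraction, stationarity and numerics into the mixing time bound *)

Theorem theorem2p7 (V : finType) (adj : rel V) (k q : nat) (Sys : V -> {set V})
  (lam : R) :
  simple_graph adj ->
  connected_graph adj ->
  (2 <= k)%N -> (k <= #|V| - 1)%N ->
  block_system adj k Sys ->
  (1 < lam)%R ->
  (2 ^ (k + 1) * INR (max_degree adj) ^ (2 * k) * INR k ^ (2 * k + 1)
     * Rpower lam (INR (max_degree adj) - 1 + / INR k) <= INR q)%R ->
  forall eps : R, (0 < eps < 1)%R ->
    mixing_time_le (BD adj q lam Sys) (gibbs adj q lam) eps
      (2 * INR #|V| * ln (INR #|V| / eps))%R.
Proof.
move=> graph conn k2 kn blocks lam1 qlarge eps eps01 x.
have n3 : (3 <= #|V|)%nat by lia.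
have d0 : (0 < max_degree adj)%nat by apply: max_degree_gt0 => //; lia.
have [v0 _] : exists v, v \in V by apply/card_gt0P; apply: leq_trans n3.
(* The starting configuration [x] gives [v0] a colour, so there is at least one. *)
have q0 : (0 < INR q)%R by apply/lt_0_INR/ltP/(leq_ltn_trans _ (ltn_ord (x v0))).
have n0 : (3 <= INR #|V|)%R by have /leP/le_INR := n3; rewrite [INR 3]/=; lra.
(* The common activity of all blocks, since each has [k] vertices. *)
set A := (Rpower lam (INR (max_degree adj) - 1 + / INR k) / INR q)%R.
set M := (2 ^ (k + 1) * INR (max_degree adj) ^ (2 * k) * INR k ^ (2 * k + 1))%R
  in qlarge.
have A0 : (0 <= A)%R.
  by apply/Rlt_le/Rdiv_lt_0_compat => //; apply: exp_pos.
have MA1 : (M * A <= 1)%R.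
  rewrite /A /Rdiv -Rmult_assoc; apply: (Rmult_le_reg_r (INR q)) => //.
  by rewrite Rmult_assoc Rinv_l; lra.
have M1 : (1 <= M)%R.
  have k1 : (1 <= INR k)%R by have /leP/le_INR : (1 <= k)%nat by lia.
  have d1 : (1 <= INR (max_degree adj))%R by have /leP/le_INR := d0.
  have p1 : (1 <= 2 ^ (k + 1))%R by apply: pow_R1_Rle; lra.
  have := pow_R1_Rle _ (2 * k) d1; have := pow_R1_Rle _ (2 * k + 1) k1.
  rewrite /M => le1 le2; rewrite -[1%R](Rmult_1_r 1) -{1}(Rmult_1_r 1).
  by apply: Rmult_le_compat => //; try lra; apply: Rmult_le_compat; lra.
have A1 : (A <= 1)%R by nra.
have actA v : activity adj q lam (Sys v) = A.
  by have [_ cardS _] := blocks v; rewrite /activity cardS.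
have W0 : (0 < rsum (fun s : config V q => lam ^ mu adj s))%R.
  by apply: (rsum_pos x) => s; apply: pow_lt; lra.
have [t [tT small]] := contraction_time n0 eps01.
exists t; split=> //; apply: Rle_trans small.
apply: tv_dist_lipschitz_contraction.
- move=> s; apply/Rlt_le/Rdiv_lt_0_compat => //; apply: pow_lt; lra.
- by rewrite /gibbs /Rdiv rsum_mulr; apply/Rinv_r/Rgt_not_eq.
- by move=> f; apply: gibbs_stationary => //; lia.
- have : (/ INR #|V| <= / 3)%R by apply: Rinv_le_contravar; lra.
  by rewrite /Rdiv; lra.
move=> D f D0 lip; apply: expect_BD_lipschitz actA _ _ D0 lip => //.
exact: neighbourhood_size_le.
Qed.
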